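(* Let $K$ be a loop with identity $\epsilon$ and $G$ a group with identity $e$. An Albert extension $K\times^{\triangledown}G$ of $G$ by $K$ is right nuclear if and only if the function $\triangledown$ has the form $\triangledown_{\xi,\eta}(x,y)=\Gamma_{\xi,\eta}(x)\,y$ for all $\xi,\eta\in K$, $x,y\in G$, where $\Gamma:K\times K\to\mathrm{Sym}(G)$ is a map with $\Gamma_{\epsilon,\sigma}(e)=e$ and $\Gamma_{\sigma,\epsilon}=\mathrm{Id}$ for all $\sigma\in K$.
   Context: $\mathrm{Sym}(G)$ is the group of all permutations of the set $G$. An Albert extension $K\times^{\triangledown}G$ of $G$ by $K$ is the loop on $K\times G$ with multiplication $(\alpha,a)(\beta,b)=(\alpha\beta,\triangledown_{\alpha,\beta}(a,b))$, where $\triangledown_{\alpha,\beta}:G\times G\to G$ ($\alpha,\beta\in K$) are quasigroup multiplications such that (a) $\triangledown_{\epsilon,\epsilon}$ is the multiplication of $G$; (b) $e$ is a left identity of $\triangledown_{\epsilon,\alpha}$ for all $\alpha\in K$; (c) $e$ is a two-sided identity of $\triangledown_{\alpha,\epsilon}$ for all $\alpha\in K$. It is right nuclear if $\{\epsilon\}\times G$ is contained in the right nucleus $\{u: xy\cdot u=x\cdot yu\ \forall x,y\}$ of the loop. *)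

(* Defs.v *)
From HB Require Import structures.
From mathcomp Require Import all_boot.

Set Implicit Arguments.
Unset Strict Implicit.
Unset Printing Implicit Defensive.

Local Open Scope group_scope.

Definition quasigroup_mul (T : Type) (op : T -> T -> T) : Prop :=
  (forall a b, exists! x, op a x = b) /\ (forall a b, exists! y, op y a = b).

HB.mixin Record UMagma_isLoop L of UMagma L := {
  mulg_quasigroup : quasigroup_mul (@mul L)
}.

#[short(type="loopType")]
HB.structure Definition Loop := {L of UMagma_isLoop L & UMagma L}.

Definition right_nucleus (L : loopType) (u : L) : Prop :=
  forall x y : L, (x * y) * u = x * (y * u).

(* MathComp's {perm G} is restricted to finite types. *)
Record Sym (G : Type) := MkSym {
  sym_fun :> G -> G;
  sym_bij : bijective sym_fun
}.

Record albert_nabla (K : loopType) (G : groupType) := MkAlbertNabla {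
  nabla :> K -> K -> G -> G -> G;
  nabla_quasigroup : forall al be : K, quasigroup_mul (nabla al be);
  nabla11 : forall a b : G, nabla 1 1 a b = a * b;
  nabla1_left_id : forall al : K, left_id 1 (nabla 1 al);
  nabla_1_left_id : forall al : K, left_id 1 (nabla al 1);
  nabla_1_right_id : forall al : K, right_id 1 (nabla al 1)
}.

(* An alias of K * G, which already carries the componentwise product. *)
Definition albert_ext (K : loopType) (G : groupType)
  (D : albert_nabla K G) : Type := (K * G)%type.

Section AlbertExtension.
Variables (K : loopType) (G : groupType) (D : albert_nabla K G).
Local Notation E := (albert_ext D).

Definition albert_mul (x y : E) : E := (x.1 * y.1, D x.1 y.1 x.2 y.2).
Definition albert_one : E := (1, 1).

Lemma albert_mul1g : left_id albert_one albert_mul.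
Proof. by case=> al a; rewrite /albert_mul /= mul1g nabla1_left_id. Qed.

Lemma albert_mulg1 : right_id albert_one albert_mul.
Proof. by case=> al a; rewrite /albert_mul /= mulg1 nabla_1_right_id. Qed.

Lemma albert_mul_quasigroup : quasigroup_mul albert_mul.
Proof.
have [KL KR] := @mulg_quasigroup K.
split=> -[al a] [be b].
  have [ga [gaE gaU]] := KL al be.
  have [c [cE cU]] := (nabla_quasigroup D al ga).1 a b.
  exists (ga, c); split=> [|[ga' c'] [/gaU <- /cU <- //]].
  by rewrite /albert_mul /= gaE cE.
have [ga [gaE gaU]] := KR al be.
have [c [cE cU]] := (nabla_quasigroup D ga al).2 a b.
exists (ga, c); split=> [|[ga' c'] [/gaU <- /cU <- //]].
by rewrite /albert_mul /= gaE cE.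
Qed.

HB.instance Definition _ := Choice.on E.
HB.instance Definition _ := hasMul.Build E albert_mul.
HB.instance Definition _ :=
  Magma_isUMagma.Build E albert_mul1g albert_mulg1.
HB.instance Definition _ := UMagma_isLoop.Build E albert_mul_quasigroup.

End AlbertExtension.

Definition right_nuclear (K : loopType) (G : groupType)
    (D : albert_nabla K G) : Prop :=
  forall g : G, right_nucleus ((1, g) : albert_ext D).

(* Main.v *)
(* Right nuclearity reads D_{xi eta, 1}(D_{xi, eta}(x, y), g) = D_{xi, eta}(x, D_{eta, 1}(y, g)).
   Taking eta = 1 and x = 1 forces D_{sigma, 1} to be the product of G; taking
   y = 1 then gives D_{xi, eta}(x, g) = D_{xi, eta}(x, 1) g, so Gamma_{xi, eta}
   must be the right translation by 1, bijective since D_{xi, eta} is a quasigroup. *)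

Require Import Defs.
From mathcomp Require Import all_boot.

Local Open Scope group_scope.

(** Phrasing existence with the boolean [==] lets [xchoose] select a preimage of each point, giving
    a right inverse; uniqueness makes it a left inverse too. *)
Lemma exists_unique_bij (A : choiceType) (B : eqType) (f : A -> B) :
  (forall b, exists! a, f a = b) -> bijective f.
Proof.
move=> fU.
have ex b : exists a, f a == b by have [a [/eqP fa _]] := fU b; exists a.
have invK b : f (xchoose (ex b)) = b by apply/eqP/(xchooseP (ex b)).
exists (fun b => xchoose (ex b)) => // a.
have [a' [_ U]] := fU (f a).
by rewrite -(U _ (invK _)); apply: U.
Qed.

(** The third factor has [K]-component 1, so the [K]-components agree automatically and only the
    [G]-components carry a condition. *)
Lemma right_nuclearP (K : loopType) (G : groupType) (D : albert_nabla K G) :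
  right_nuclear D <->
  forall (xi eta : K) (x y g : G),
    D (xi * eta) 1 (D xi eta x y) g = D xi eta x (D eta 1 y g).
Proof.
split=> [nuc xi eta x y g | nuc g [xi x] [eta y]].
  have [_] := nuc g (xi, x) (eta, y).
  by rewrite /= mulg1.
by congr (_, _) => /=; rewrite !mulg1 // nuc.
Qed.

Theorem lemma17 (K : loopType) (G : groupType) (D : albert_nabla K G) :
  right_nuclear D <->
  exists Gamma : K -> K -> Sym G,
    [/\ forall (xi eta : K) (x y : G), D xi eta x y = Gamma xi eta x * y,
        forall sigma : K, Gamma 1 sigma 1 = 1
      & forall (sigma : K) (x : G), Gamma sigma 1 x = x].
Proof.
apply: (iff_trans (right_nuclearP _ _ D)).
split=> [nuc | [Gamma [DE _ Gamma_1]] xi eta x y g].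
  have D_1 sigma y g : D sigma 1 y g = y * g.
    by have := nuc sigma 1 1 y g; rewrite mulg1 nabla11 !nabla_1_left_id.
  have D_bij xi eta : bijective (fun x => D xi eta x 1).
    exact/exists_unique_bij/(nabla_quasigroup D xi eta).2.
  exists (fun xi eta => MkSym (D_bij xi eta)).
  split=> [xi eta x y | sigma | sigma x] /=.
  - by have := nuc xi eta x 1 y; rewrite !D_1 mul1g.
  - exact: nabla1_left_id.
  - exact: nabla_1_right_id.
(* As [Gamma _ 1] is the identity, both sides equal [Gamma xi eta x * y * g]. *)
by rewrite !DE !Gamma_1 mulgA.
Qed.
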